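(* Let $(X,\omega)$ be a complex symplectic vector space with transversal subspaces $\lambda,\mu$, i.e. $X=\lambda\oplus\mu$. If $\lambda,\mu$ are isotropic subspaces, then they are Lagrangian subspaces.
   Context: A complex symplectic vector space is a complex vector space $X$ (no topology) with a map $\omega\colon X\times X\to\mathbb C$, linear in the first and conjugate linear in the second variable, with $\omega(y,x)=-\overline{\omega(x,y)}$, and non-degenerate: $\omega(x,y)=0$ for all $y$ implies $x=0$. For a subspace $\lambda$, $\lambda^\omega=\{y\in X:\omega(x,y)=0\ \forall x\in\lambda\}$; $\lambda$ is isotropic if $\lambda\subset\lambda^\omega$ and Lagrangian if $\lambda=\lambda^\omega$. *)

(* Defs.v *)
From HB Require Import structures.
From mathcomp Require Import all_boot all_order all_algebra.
From mathcomp Require Import boolp classical_sets reals.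
From mathcomp Require Import complex.

Set Implicit Arguments.
Unset Strict Implicit.
Unset Printing Implicit Defensive.

Import Order.TTheory GRing.Theory Num.Theory.
Local Open Scope classical_set_scope.
Local Open Scope ring_scope.

(* Linear in the first variable, conjugate linear in the second; the flag
   [true] gives the sign in omega x y = (-1) ^+ true * (omega y x)^*. *)
Notation skew_hermitian_form R X :=
  ({hermitian X%type for true & @Num.conj R[i]}).

Section Symplectic.
Variables (R : realType) (X : lmodType R[i]).

Definition is_subspace (lam : set X) : Prop := submod_closed [in lam].

(* The internal direct sum decomposition X = lam (+) mu. *)
Definition transversal_subspaces (lam mu : set X) : Prop :=
  [set x + y | x in lam & y in mu] = [set: X] /\ lam `&` mu = [set 0].

Variable omega : skew_hermitian_form R X.

(* [sesquilinear.nondegenerate] is restricted to finite dimension. *)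
Definition nondegenerate_form : Prop :=
  forall x : X, (forall y : X, omega x y = 0) -> x = 0.

Definition annihilator (lam : set X) : set X :=
  [set y | forall x, lam x -> omega x y = 0].

Definition isotropic (lam : set X) : Prop := lam `<=` annihilator lam.

Definition lagrangian (lam : set X) : Prop := lam = annihilator lam.

End Symplectic.

(* Main.v *)
Require Import Defs.
From HB Require Import structures.
From mathcomp Require Import all_boot all_order all_algebra.
From mathcomp Require Import boolp classical_sets reals.
From mathcomp Require Import complex.

Set Implicit Arguments.
Unset Strict Implicit.
Unset Printing Implicit Defensive.

Import Order.TTheory GRing.Theory Num.Theory.
Local Open Scope classical_set_scope.
Local Open Scope ring_scope.

(** If [y = a + b], with [a] in [lam] and [b] in [mu], annihilates [lam], then
    so does [b = y - a], because [lam] is isotropic; and [b] annihilates [mu]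
    because [mu] is. Hence [b] is orthogonal to [lam + mu = X], so [b = 0] by
    non-degeneracy and [y = a] lies in [lam]. The argument is symmetric in
    [lam] and [mu]. *)

Lemma spanning_isotropic_lagrangian (R : realType) (X : lmodType R[i])
    (omega : skew_hermitian_form R X) (lam mu : set X) :
  nondegenerate_form omega -> [set x + y | x in lam & y in mu] = [set: X] ->
  isotropic omega lam -> isotropic omega mu -> lagrangian omega lam.
Proof.
move=> nondeg span iso_lam iso_mu; apply/seteqP; split=> // y ann_y.
have [a lam_a [b mu_b def_y]] : [set x + z | x in lam & z in mu] y.
  by rewrite span.
suff b0 : b = 0 by rewrite -def_y b0 addr0.
(* Non-degeneracy concerns the first variable, the annihilator the second. *)
apply: nondeg => z; rewrite hermC.
have [u lam_u [v mu_v <-]] : [set x + z | x in lam & z in mu] z.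
  by rewrite span.
have omega_ub : omega u b = 0.
  by have := ann_y u lam_u; rewrite -def_y linearDr /= iso_lam// add0r.
by rewrite linearDl /= omega_ub (iso_mu _ mu_b _ mu_v) addr0 rmorph0 mulr0.
Qed.

Theorem lemma4 (R : realType) (X : lmodType R[i])
    (omega : skew_hermitian_form R X) (omega_nondeg : nondegenerate_form omega)
    (lam mu : set X) (lam_sub : is_subspace lam) (mu_sub : is_subspace mu)
    (lam_mu_transversal : transversal_subspaces lam mu)
    (lam_isotropic : isotropic omega lam) (mu_isotropic : isotropic omega mu) :
  lagrangian omega lam /\ lagrangian omega mu.
Proof.
have [span _] := lam_mu_transversal.
split; first exact: spanning_isotropic_lagrangian span _ _.
apply: (@spanning_isotropic_lagrangian _ _ _ mu lam) => //.
apply/seteqP; split=> // z _.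
have [u lam_u [v mu_v <-]] : [set x + y | x in lam & y in mu] z.
  by rewrite span.
by exists v => //; exists u => //; rewrite addrC.
Qed.
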